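(* In the source coding problem with receiver side information described in the context, suppose $X=Y$ (i.e. $X_i=Y_i$ for all $i$). Then the set $\mathcal{R}$ of achievable rate triples equals the closure of $\bigcup_{p\in\mathcal{P}^*}\mathcal{R}^{(p)*}$.
   Context: Let $\mathcal{X},\mathcal{Y},\mathcal{U},\mathcal{V}$ be finite sets and let $\{(X_i,Y_i,U_i,V_i)\}_{i\ge1}$ be i.i.d. with joint distribution $\mathcal{Q}_{XYUV}$. For $i=0,1,2$ let $\mathcal{M}_i=\{1,\dots,|\mathcal{M}_i|\}$ be finite index sets. A code of block length $n$ consists of an encoder $e^{(n)}:\mathcal{X}^n\times\mathcal{Y}^n\to\mathcal{M}_0\times\mathcal{M}_1\times\mathcal{M}_2$, $(M_0,M_1,M_2)=e^{(n)}(X^n,Y^n)$, a decoder $d_x^{(n)}:\mathcal{M}_0\times\mathcal{M}_1\times\mathcal{U}^n\to\mathcal{X}^n$, $\widehat X^n=d_x^{(n)}(M_0,M_1,U^n)$, and a decoder $d_y^{(n)}:\mathcal{M}_0\times\mathcal{M}_2\times\mathcal{V}^n\to\mathcal{Y}^n$, $\widehat Y^n=d_y^{(n)}(M_0,M_2,V^n)$. Let $P_e=\max\{\Pr[\widehat X^n\ne X^n],\Pr[\widehat Y^n\ne Y^n]\}$. A triple $(R_0,R_1,R_2)$ is achievable if for every $\epsilon>0$ and all sufficiently large $n$ there is such a code with $P_e\le\epsilon$ and $(1/n)\log_2|\mathcal{M}_i|\le R_i+\epsilon$, $i=0,1,2$; $\mathcal{R}$ is the set of achievable triples. Let $\mathcal{A},\mathcal{B}$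 be finite sets with $|\mathcal{A}|\le|\mathcal{X}|+1$, $|\mathcal{B}|\le|\mathcal{X}|+1$. Let $\mathcal{P}^*$ be the family of probability functions $p$ on $\mathcal{A}\times\mathcal{B}\times\mathcal{X}\times\mathcal{U}\times\mathcal{V}$ with $p(a,b,x,u,v)=p(a,b|x)p(x,u,v)$ and $\sum_{(a,b)}p(a,b,x,u,v)=\mathcal{Q}_{XUV}(x,u,v)$ (the $(X,U,V)$-marginal of the source). For $p\in\mathcal{P}^*$ let $\mathcal{R}^{(p)*}$ be the set of $(R_0,R_1,R_2)$ with $R_0\ge\max\{H_p(X|A,U),H_p(X|B,V)\}$, $R_1\ge I_p(X;A|U)$, $R_2\ge I_p(X;B|V)$. *)

(* Defs.v *)
From HB Require Import structures.
From mathcomp Require Import all_boot all_order all_algebra.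
From mathcomp Require Import all_classical all_reals all_analysis.
Set Implicit Arguments. Unset Strict Implicit. Unset Printing Implicit Defensive.
Import Order.TTheory GRing.Theory Num.Theory.
Import numFieldNormedType.Exports.
Local Open Scope classical_set_scope.
Local Open Scope ring_scope.

Section Defs.
Variable R : realType.

Definition log2 (x : R) : R := ln x / ln 2.
Definition xlog2x (x : R) : R := if x == 0 then 0 else x * log2 x.

Definition is_pmf {T : finType} (p : {ffun T -> R}) : Prop :=
  (forall t, 0 <= p t) /\ \sum_(t : T) p t = 1.

Definition ent {T S : finType} (p : {ffun T -> R}) (f : T -> S) : R :=
  - \sum_(s : S) xlog2x (\sum_(t : T | f t == s) p t).

Definition condent {T S1 S2 : finType} (p : {ffun T -> R})
  (f : T -> S1) (g : T -> S2) : R :=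
  ent p (fun t => (f t, g t)) - ent p g.

Definition cmi {T S1 S2 S3 : finType} (p : {ffun T -> R})
  (f : T -> S1) (g : T -> S2) (k : T -> S3) : R :=
  condent p f k - condent p f (fun t => (g t, k t)).

Variables X U V : finType.
(* The source alphabet of Y is taken equal to that of X (the case X = Y). *)
Definition src := (X * X * U * V)%type.

Definition QXUV (Q : {ffun src -> R}) (x : X) (u : U) (v : V) : R :=
  \sum_(y : X) Q (x, y, u, v).

Definition prob_n (Q : {ffun src -> R}) (n : nat)
  (E : {ffun 'I_n -> src} -> bool) : R :=
  \sum_(s : {ffun 'I_n -> src}) (\prod_(i < n) Q (s i)) * (E s)%:R.

Definition xs_of n (s : {ffun 'I_n -> src}) : {ffun 'I_n -> X} :=
  [ffun i => (s i).1.1.1].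
Definition ys_of n (s : {ffun 'I_n -> src}) : {ffun 'I_n -> X} :=
  [ffun i => (s i).1.1.2].
Definition us_of n (s : {ffun 'I_n -> src}) : {ffun 'I_n -> U} :=
  [ffun i => (s i).1.2].
Definition vs_of n (s : {ffun 'I_n -> src}) : {ffun 'I_n -> V} :=
  [ffun i => (s i).2].

Definition Perr (Q : {ffun src -> R}) (n m0 m1 m2 : nat)
  (e : {ffun 'I_n -> X} -> {ffun 'I_n -> X} -> 'I_m0 * 'I_m1 * 'I_m2)
  (dx : 'I_m0 -> 'I_m1 -> {ffun 'I_n -> U} -> {ffun 'I_n -> X})
  (dy : 'I_m0 -> 'I_m2 -> {ffun 'I_n -> V} -> {ffun 'I_n -> X}) : R :=
  Num.max
    (prob_n Q (fun s => let M := e (xs_of s) (ys_of s) in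
                        dx M.1.1 M.1.2 (us_of s) != xs_of s))
    (prob_n Q (fun s => let M := e (xs_of s) (ys_of s) in
                        dy M.1.1 M.2 (vs_of s) != ys_of s)).

Definition achievable (Q : {ffun src -> R}) (r : R * R * R) : Prop :=
  forall eps : R, 0 < eps ->
  exists N : nat, forall n : nat, (N <= n)%N ->
  exists (m0 m1 m2 : nat)
    (e : {ffun 'I_n -> X} -> {ffun 'I_n -> X} -> 'I_m0 * 'I_m1 * 'I_m2)
    (dx : 'I_m0 -> 'I_m1 -> {ffun 'I_n -> U} -> {ffun 'I_n -> X})
    (dy : 'I_m0 -> 'I_m2 -> {ffun 'I_n -> V} -> {ffun 'I_n -> X}),
    [/\ Perr Q e dx dy <= eps,
        log2 m0%:R / n%:R <= r.1.1 + eps,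
        log2 m1%:R / n%:R <= r.1.2 + eps &
        log2 m2%:R / n%:R <= r.2 + eps].

Definition rate_region (Q : {ffun src -> R}) : set (R * R * R) :=
  [set r | achievable Q r].

Definition in_Pstar (A B : finType) (Q : {ffun src -> R})
  (p : {ffun A * B * X * U * V -> R}) : Prop :=
  exists W : X -> A * B -> R,
    (forall x ab, 0 <= W x ab) /\ (forall x, \sum_(ab : A * B) W x ab = 1) /\
    (forall a b x u v, p (a, b, x, u, v) = W x (a, b) * QXUV Q x u v).

Definition Rpstar (A B : finType) (p : {ffun A * B * X * U * V -> R})
  : set (R * R * R) :=
  let a := fun t : A * B * X * U * V => t.1.1.1.1 in
  let b := fun t : A * B * X * U * V => t.1.1.1.2 in
  let x := fun t : A * B * X * U * V => t.1.1.2 in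
  let u := fun t : A * B * X * U * V => t.1.2 in
  let v := fun t : A * B * X * U * V => t.2 in
  [set r | [/\ Num.max (condent p x (fun t => (a t, u t)))
                       (condent p x (fun t => (b t, v t))) <= r.1.1,
               cmi p x a u <= r.1.2 &
               cmi p x b v <= r.2]].

Definition inner_union (Q : {ffun src -> R}) : set (R * R * R) :=
  [set r | exists (A B : finType), [/\ (#|A| <= #|X|.+1)%N, (#|B| <= #|X|.+1)%N &
      exists p : {ffun A * B * X * U * V -> R}, in_Pstar Q p /\ Rpstar p r]].

End Defs.

(* Main.v *)
(** Both sides equal the polyhedron [R0, R1, R2 >= 0], [H(X|U) <= R0 + R1],
    [H(X|V) <= R0 + R2].

    Single-letter side: [I(X;A|U) = H(X|U) - H(X|A,U)] gives one inclusion.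
    Conversely, if [A] is [X] erased with probability [k] (an alphabet of
    [|X| + 1] letters), then [H(X|A,U) = k H(X|U)], so every split of [H(X|U)]
    between [R0] and [R1] occurs.

    Coding side: by Chebyshev, the likelihood of [X^n] given [U^n] is
    [2^(-n (H(X|U) +- d))] up to probability [O(1/n)].  For fixed side information,
    a code corrects at most [|M0| |M1|] source words, which gives the converse;
    random binning, with bins shared by the two decoders through [M0], gives
    achievability. *)
Require Import Defs.
From HB Require Import structures.
From mathcomp Require Import all_boot all_order all_algebra.
From mathcomp Require Import all_classical all_reals all_analysis.
From mathcomp Require Import ring lra.
Import Order.TTheory GRing.Theory Num.Theory.
Import numFieldNormedType.Exports.
Local Open Scope classical_set_scope.
Local Open Scope ring_scope.

Set Implicit Arguments.
Unset Strict Implicit.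
Unset Printing Implicit Defensive.

(** * Marginals, conditional probabilities and entropies of a finite pmf *)

Section Marginals.
Variables (R : realType) (T : finType) (p : {ffun T -> R}).
Hypothesis hp : is_pmf p.

Definition marg (S : finType) (f : T -> S) (s : S) : R :=
  \sum_(t | f t == s) p t.

Definition mean (f : T -> R) : R := \sum_t p t * f t.

Lemma pmf_inhabited : exists t, p t != 0.
Proof.
apply/existsP; apply: contraT; rewrite negb_exists => /forallP h.
have := proj2 hp; rewrite big1 => [/eqP|t _]; first by rewrite eq_sym oner_eq0.
by apply/eqP; have := h t; rewrite negbK.
Qed.

Lemma marg_ge0 (S : finType) (f : T -> S) s : 0 <= marg f s.
Proof. by apply: sumr_ge0 => t _; case: hp => ->. Qed.

Lemma marg_gt0 (S : finType) (f : T -> S) t : p t != 0 -> 0 < marg f (f t).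
Proof.
move=> pt; rewrite /marg (bigD1 t) //= ltr_pwDl //.
  by rewrite lt_def pt; case: hp => ->.
by apply: sumr_ge0 => u _; case: hp => ->.
Qed.

Lemma sum_marg (S : finType) (f : T -> S) (F : S -> R) :
  \sum_s marg f s * F s = mean (F \o f).
Proof.
rewrite /mean (partition_big f xpredT) //=; apply: eq_bigr => s _.
by rewrite /marg mulr_suml; apply: eq_bigr => t /eqP <-.
Qed.

Lemma sum_marg1 (S : finType) (f : T -> S) : \sum_s marg f s = 1.
Proof.
have := sum_marg f (fun=> 1); rewrite /mean /=.
by under eq_bigr do rewrite mulr1; under [in RHS]eq_bigr do rewrite mulr1; rewrite (proj2 hp).
Qed.

Lemma marg_pairl (S S' : finType) (f : T -> S) (g : T -> S') s' :
  \sum_s marg (fun t => (f t, g t)) (s, s') = marg g s'.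
Proof.
rewrite /marg [RHS](partition_big f xpredT) //=.
apply: eq_bigr => s _; apply: eq_bigl => t.
by rewrite xpair_eqE andbC.
Qed.

(* [ln 0 = 0], so that the guard in [xlog2x] can be dropped. *)
Lemma xlog2xE (x : R) : xlog2x x = x * log2 x.
Proof. by rewrite /xlog2x; case: eqP => // ->; rewrite mul0r. Qed.

Lemma xlog2xM (x y : R) : 0 <= x -> 0 <= y ->
  xlog2x (x * y) = x * xlog2x y + y * xlog2x x.
Proof.
rewrite !xlog2xE /log2 le_eqVlt => /orP[/eqP<-|x0]; first by rewrite !mul0r mulr0 addr0.
rewrite le_eqVlt => /orP[/eqP<-|y0]; first by rewrite !(mulr0, mul0r) addr0.
by rewrite lnM // ; ring.
Qed.

Lemma entE (S : finType) (f : T -> S) : ent p f = - mean (fun t => log2 (marg f (f t))).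
Proof.
rewrite /ent -(sum_marg f (fun s => log2 (marg f s))); congr (- _).
by apply: eq_bigr => s _; rewrite xlog2xE.
Qed.

Lemma eq_mean (f g : T -> R) : (forall t, p t != 0 -> f t = g t) -> mean f = mean g.
Proof.
move=> fg; apply: eq_bigr => t _.
by have [->|/fg ->//] := eqVneq (p t) 0; rewrite !mul0r.
Qed.

Lemma le_mean (f g : T -> R) : (forall t, p t != 0 -> f t <= g t) -> mean f <= mean g.
Proof.
move=> fg; apply: ler_sum => t _.
have [->|/fg h] := eqVneq (p t) 0; first by rewrite !mul0r.
by apply: ler_wpM2l => //; case: hp => ->.
Qed.

Lemma meanB (f g : T -> R) : mean (fun t => f t - g t) = mean f - mean g.
Proof. by rewrite /mean -sumrB; apply: eq_bigr => t _; rewrite mulrBr. Qed.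

Lemma meanN (f : T -> R) : mean (fun t => - f t) = - mean f.
Proof. by rewrite /mean -sumrN; apply: eq_bigr => t _; rewrite mulrN. Qed.

Lemma mean_cst (c : R) : mean (fun=> c) = c.
Proof. by rewrite /mean -mulr_suml (proj2 hp) mul1r. Qed.

(** As division by zero gives 0, [condp] vanishes identically over a letter [b] of mass zero; its
    sum over [a] is then 0, hence the inequality in [sum_condp_le1]. *)
Definition condp (X W : finType) (x : T -> X) (w : T -> W) (a : X) (b : W) : R :=
  marg (fun t => (x t, w t)) (a, b) / marg w b.

Lemma condp_ge0 (X W : finType) (x : T -> X) (w : T -> W) a b : 0 <= condp x w a b.
Proof. by rewrite /condp divr_ge0 // marg_ge0. Qed.

Lemma condp_gt0 (X W : finType) (x : T -> X) (w : T -> W) t :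
  p t != 0 -> 0 < condp x w (x t) (w t).
Proof. by move=> pt; rewrite divr_gt0 // ?marg_gt0 // (@marg_gt0 _ (fun t => (x t, w t)) t). Qed.

Lemma marg_condp (X W : finType) (x : T -> X) (w : T -> W) a b :
  marg (fun t => (x t, w t)) (a, b) = marg w b * condp x w a b.
Proof.
rewrite /condp mulrC; have [w0|w0] := eqVneq (marg w b) 0; last by rewrite divfK.
rewrite w0 mulr0; move: w0; rewrite -(marg_pairl x) => /psumr_eq0P -> // s _.
exact: marg_ge0.
Qed.

Lemma sum_condp_le1 (X W : finType) (x : T -> X) (w : T -> W) b :
  \sum_a condp x w a b <= 1.
Proof.
rewrite /condp -mulr_suml marg_pairl.
by have [->|w0] := eqVneq (marg w b) 0; rewrite ?mul0r ?ler01 ?divff.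
Qed.

Lemma condentE (X W : finType) (x : T -> X) (w : T -> W) :
  condent p x w = mean (fun t => - log2 (condp x w (x t) (w t))).
Proof.
rewrite /condent !entE -opprD -meanB -meanN; apply: eq_mean => t pt.
rewrite /log2 ln_div ?posrE ?marg_gt0 ?(@marg_gt0 _ (fun t => (x t, w t)) t) //.
by rewrite mulrBl.
Qed.

Lemma ln2_gt0 : 0 < ln 2 :> R.
Proof. by rewrite ln_gt0 // ltr1n. Qed.

Lemma condent_ge0 (X W : finType) (x : T -> X) (w : T -> W) : 0 <= condent p x w.
Proof.
rewrite condentE -(mean_cst 0); apply: le_mean => t pt.
rewrite oppr_ge0 /log2 pmulr_lle0 ?invr_gt0 ?ln2_gt0 // ln_le0 //.
apply: le_trans (sum_condp_le1 x w (w t)); rewrite (bigD1 (x t)) //= lerDl.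
by apply: sumr_ge0 => a _; exact: condp_ge0.
Qed.

(** With [r] the ratio of the two conditional probabilities, [cmi] times [ln 2] is the mean of
    [- ln r], which is at least the mean of [1 - r] since [1 + ln r <= r]. So it suffices that [r]
    has mean at most 1. *)
Lemma cmi_ge0 (X A W : finType) (x : T -> X) (a : T -> A) (w : T -> W) :
  0 <= cmi p x a w.
Proof.
rewrite /cmi !condentE -meanB.
set r := fun t => condp x w (x t) (w t) / condp x (fun t => (a t, w t)) (x t) (a t, w t).
suff: mean r <= 1.
  move=> r1; rewrite -(pmulr_lge0 _ ln2_gt0) /mean mulr_suml.
  apply: (@le_trans _ _ (mean (fun t => 1 - r t))).
    by rewrite meanB mean_cst subr_ge0.
  apply: ler_sum => t _.
  have [->|pt] := eqVneq (p t) 0; first by rewrite !mul0r.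
  rewrite -mulrA ler_wpM2l //; first by case: hp => ->.
  have L0 := ln2_gt0;
    have [h1 h2] := (@condp_gt0 _ _ x w _ pt, @condp_gt0 _ _ x (fun t => (a t, w t)) _ pt).
  set c := condp _ _ _ _ in h1 *; set c' := condp _ _ _ _ in h2 *.
  rewrite (_ : (_ - _) * _ = - (ln c - ln c')); last first.
    by rewrite /log2; field; rewrite lt0r_neq0.
  rewrite -ln_div ?posrE // -/(r t) lerNr opprB lerBrDl.
  have r0 : 0 < r t by rewrite divr_gt0.
  by have := expR_ge1Dx (ln (r t)); rewrite lnK // => /le_trans; apply.
(* The mean becomes a sum over letters, where the joint mass factors as the mass of the pair
   [(a, w)] times the denominator of [r]. That denominator cancels and leaves a conditional law
   given [w] alone, of total at most 1. *)
rewrite (_ : mean r = \sum_(s : X * (A * W)) marg (fun t => (x t, (a t, w t))) s *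
   (condp x w s.1 s.2.2 / condp x (fun t => (a t, w t)) s.1 s.2)); last by rewrite sum_marg.
rewrite -(pair_bigA _ (fun a0 s => marg (fun t => (x t, (a t, w t))) (a0, s) *
   (condp x w a0 s.2 / condp x (fun t => (a t, w t)) a0 s))) exchange_big /=.
rewrite -[leRHS](sum_marg1 (fun t => (a t, w t))); apply: ler_sum => s _.
rewrite -[leRHS]mulr1; apply: le_trans (ler_wpM2l (marg_ge0 _ _) (sum_condp_le1 x w s.2)).
rewrite mulr_sumr; apply: ler_sum => a0 _; rewrite marg_condp.
set c := condp _ _ _ s; rewrite -mulrA ler_wpM2l ?marg_ge0 //.
have [->|c0] := eqVneq c 0; first by rewrite mul0r condp_ge0.
by rewrite mulrCA divff // mulr1.
Qed.

End Marginals.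

(** * Expectation under the i.i.d. law and the weak law of large numbers *)

Section ProductMeasure.
Variables (R : realType) (T : finType) (p : {ffun T -> R}).
Hypothesis hp : is_pmf p.

Definition mean_n (n : nat) (F : {ffun 'I_n -> T} -> R) : R :=
  \sum_(s : {ffun 'I_n -> T}) (\prod_i p (s i)) * F s.

Lemma prod_pmf_ge0 n (s : {ffun 'I_n -> T}) : 0 <= \prod_i p (s i).
Proof. by apply: prodr_ge0 => i _; case: hp => ->. Qed.

Lemma le_mean_n n (F G : {ffun 'I_n -> T} -> R) :
  (forall s : {ffun 'I_n -> T}, \prod_i p (s i) != 0 -> F s <= G s) -> mean_n F <= mean_n G.
Proof.
move=> FG; apply: ler_sum => s _.
have [->|/FG h] := eqVneq (\prod_i p (s i)) 0; first by rewrite !mul0r.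
by rewrite ler_wpM2l // prod_pmf_ge0.
Qed.

Lemma mean_nD n (F G : {ffun 'I_n -> T} -> R) :
  mean_n (fun s : {ffun 'I_n -> T} => F s + G s) = mean_n F + mean_n G.
Proof. by rewrite /mean_n -big_split; apply: eq_bigr => s _; rewrite mulrDr. Qed.

Lemma mean_n_sum n (I : finType) (F : I -> {ffun 'I_n -> T} -> R) :
  mean_n (fun s : {ffun 'I_n -> T} => \sum_i F i s) = \sum_i mean_n (F i).
Proof.
by rewrite /mean_n exchange_big; apply: eq_bigr => s _; rewrite mulr_sumr.
Qed.

Lemma mean_n_prod n (f : 'I_n -> T -> R) :
  mean_n (fun s : {ffun 'I_n -> T} => \prod_i f i (s i)) = \prod_i mean p (f i).
Proof.
rewrite /mean bigA_distr_bigA; apply: eq_bigr => s _.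
by rewrite big_split.
Qed.

Lemma mean_n_cst n (c : R) : mean_n (fun _ : {ffun 'I_n -> T} => c) = c.
Proof.
rewrite /mean_n -mulr_suml.
have := bigA_distr_bigA (fun (_ : 'I_n) t => p t) => /= <-.
by rewrite big1 ?mul1r // => i _; exact: (proj2 hp).
Qed.

Lemma mean_n_coord2 n (g : T -> R) (i j : 'I_n) : mean p g = 0 ->
  mean_n (fun s : {ffun 'I_n -> T} => g (s i) * g (s j)) =
    if i == j then mean p (fun t => g t ^+ 2) else 0.
Proof.
move=> g0.
(* [f h] carries [g] at coordinate [h] and 1 elsewhere, so that [g (s i) * g (s j)] becomes a
   product over all coordinates and its mean factors. *)
pose f (h k : 'I_n) t := if k == h then g t else 1.
have fE h (s : {ffun 'I_n -> T}) : \prod_k f h k (s k) = g (s h).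
  by rewrite (bigD1 h) //= {1}/f eqxx big1 ?mulr1 // => k /negPf; rewrite /f => ->.
transitivity (mean_n (fun s : {ffun 'I_n -> T} => \prod_k (f i k (s k) * f j k (s k)))).
  by apply: eq_bigr => s _; rewrite big_split !fE.
rewrite (mean_n_prod (fun k t => f i k t * f j k t)) (bigD1 i) //= {1}/f eqxx.
case: eqVneq => [<-|ij].
  rewrite big1 => [|k ki]; last by rewrite /f (negPf ki) -[RHS](mean_cst hp 1);
    apply: eq_bigr => t _; rewrite mulr1.
  by rewrite mulr1; apply: eq_bigr => t _; rewrite /f eqxx expr2.
rewrite (_ : mean p _ = 0) ?mul0r // -g0; apply: eq_bigr => t _.
by rewrite /f (negPf ij) mulr1.
Qed.

(** Chebyshev's inequality; [C] is the variance of [f] divided by [d ^+ 2], hence independent of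
    [n]. *)
Lemma weak_law (f : T -> R) (d : R) : 0 < d ->
  exists2 C : R, 0 <= C & forall n, (0 < n)%N ->
    mean_n (fun s : {ffun 'I_n -> T} =>
      (n%:R * d <= `|\sum_i f (s i) - n%:R * mean p f|)%R%:R) <= C / n%:R.
Proof.
move=> d0; pose g t := f t - mean p f.
have g0 : mean p g = 0 by rewrite meanB mean_cst // subrr.
have var0 : 0 <= mean p (fun t => g t ^+ 2).
  by apply: sumr_ge0 => t _; rewrite mulr_ge0 ?sqr_ge0 //; case: hp => ->.
exists (mean p (fun t => g t ^+ 2) / d ^+ 2); first by rewrite divr_ge0 // sqr_ge0.
move=> n n0; have n0' : 0 < n%:R :> R by rewrite ltr0n.
have nd0 : 0 < (n%:R * d) ^+ 2 by rewrite exprn_gt0 // mulr_gt0.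
rewrite -(ler_pM2r nd0) {1}/mean_n mulr_suml.
rewrite (_ : _ / _ * _ = n%:R * mean p (fun t => g t ^+ 2)); last first.
  by field; rewrite !lt0r_neq0.
(* The variance of the sum is [n] times the variance of one term: expanding the square, the
   off-diagonal products of centred terms have mean 0. *)
have -> : n%:R * mean p (fun t => g t ^+ 2) =
    mean_n (fun s : {ffun 'I_n -> T} => (\sum_i g (s i)) ^+ 2).
  rewrite (_ : mean_n _ = mean_n (fun s : {ffun 'I_n -> T} => \sum_i \sum_j g (s i) * g (s j)));
    last first.
    by apply: eq_bigr => s _; rewrite expr2 mulr_suml; congr (_ * _); apply: eq_bigr => i _;
      rewrite mulr_sumr.
  rewrite mean_n_sum (eq_bigr (fun=> mean p (fun t => g t ^+ 2))) => [|i _].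
    by rewrite sumr_const card_ord mulr_natl.
  rewrite mean_n_sum (bigD1 i) //= mean_n_coord2 // eqxx big1 ?addr0 // => j ji.
  by rewrite mean_n_coord2 // eq_sym (negPf ji).
apply: ler_sum => s _; rewrite -mulrA ler_wpM2l ?prod_pmf_ge0 //.
have -> : \sum_i g (s i) = \sum_i f (s i) - n%:R * mean p f.
  by rewrite sumrB sumr_const card_ord mulr_natl.
have [h|_] := boolP (n%:R * d <= _); rewrite ?mul0r ?sqr_ge0 ?mul1r //.
by rewrite -[leRHS]real_normK ?num_real // lerXn2r ?nnegrE ?mulr_ge0 // ltW.
Qed.

(** [xs_of], [us_of] and [vs_of] are convertible to instances of [vmap], which lets the general
    bounds below apply directly to codes. *)
Definition vmap (S : finType) (f : T -> S) {n : nat} (s : {ffun 'I_n -> T}) : {ffun 'I_n -> S} :=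
  [ffun i => f (s i)].

(** Disintegration: the side-information word is drawn first, then the source word given it. The
    sequences with prescribed images form a product of fibres, so the law factors letter by
    letter. *)
Lemma mean_n_marg (X W : finType) (x : T -> X) (w : T -> W) n
    (G : {ffun 'I_n -> X} -> {ffun 'I_n -> W} -> R) :
  mean_n (fun s : {ffun 'I_n -> T} => G (vmap x s) (vmap w s)) =
  \sum_(b : {ffun 'I_n -> W}) (\prod_i marg p w (b i)) *
    \sum_(a : {ffun 'I_n -> X}) (\prod_i condp p x w (a i) (b i)) * G a b.
Proof.
rewrite /mean_n (partition_big (vmap w) xpredT) //=; apply: eq_bigr => b _.
rewrite (partition_big (vmap x) xpredT) //= mulr_sumr; apply: eq_bigr => a _.
rewrite mulrA -big_split /= (eq_bigr (fun i => marg p (fun t => (x t, w t)) (a i, b i)));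
  last first.
  by move=> i _; rewrite marg_condp.
rewrite [in RHS]/marg bigA_distr_big_dep mulr_suml /=; apply: eq_big => s.
  apply/andP/familyP => [[/eqP <- /eqP <-] i|h].
    by rewrite unfold_in !ffunE eqxx.
  by split; apply/eqP/ffunP => i; have := h i;
    rewrite unfold_in ffunE xpair_eqE => /andP[/eqP ? /eqP ?].
by move=> /andP[/eqP <- /eqP <-].
Qed.

End ProductMeasure.

(** * Typicality, the counting converse and random binning for one decoder *)

Section Coding.
Variables (R : realType) (T X W : finType) (p : {ffun T -> R}).
Variables (x : T -> X) (w : T -> W).
Hypothesis hp : is_pmf p.

Definition lik (n : nat) (a : {ffun 'I_n -> X}) (b : {ffun 'I_n -> W}) : R :=
  \prod_i condp p x w (a i) (b i).

(** The information density is kept in nats to match [expR]; this is the source of the factors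
    [ln 2] below. *)
Definition info (t : T) : R := - ln (condp p x w (x t) (w t)).

Definition atypical (d : R) (n : nat) (s : {ffun 'I_n -> T}) : bool :=
  n%:R * d <= `|\sum_i info (s i) - n%:R * mean p info|.

Lemma mean_info : mean p info = condent p x w * ln 2.
Proof.
rewrite condentE // /mean mulr_suml; apply: eq_bigr => t _.
by rewrite /info /log2 -mulrA mulNr divfK ?lt0r_neq0 ?ln2_gt0.
Qed.

Lemma lik_ge0 n (a : {ffun 'I_n -> X}) b : 0 <= lik a b.
Proof. by apply: prodr_ge0 => i _; exact: condp_ge0. Qed.

Lemma sum_lik_le1 n (b : {ffun 'I_n -> W}) : \sum_a lik a b <= 1.
Proof.
rewrite -(bigA_distr_bigA (fun i a => condp p x w a (b i))) /=.
apply: prodr_ile1 => i _.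
rewrite sum_condp_le1 // andbT; apply: sumr_ge0 => a _; exact: condp_ge0.
Qed.

Lemma sum_lik_gt_le n (b : {ffun 'I_n -> W}) (c : R) : 0 < c ->
  \sum_(a : {ffun 'I_n -> X}) ((c <= lik a b)%R%:R : R) <= c^-1.
Proof.
move=> c0; rewrite -(ler_pM2l c0) divff ?lt0r_neq0 // mulr_sumr.
apply: le_trans (sum_lik_le1 b); apply: ler_sum => a _.
by have [h|_] := boolP (c <= lik a b); rewrite ?mulr1 ?mulr0 ?lik_ge0.
Qed.

Lemma likE n (s : {ffun 'I_n -> T}) : \prod_i p (s i) != 0 ->
  lik (vmap x s) (vmap w s) = expR (- \sum_i info (s i)).
Proof.
move=> /prodf_neq0 ps; rewrite -sumrN expR_sum; apply: eq_bigr => i _.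
by rewrite /info opprK !ffunE lnK // posrE condp_gt0 // ps.
Qed.

(** The asymptotic equipartition property: outside the atypical event the likelihood is known up to
    a factor [expR (n * d)] in each direction. *)
Lemma likP n (s : {ffun 'I_n -> T}) (d : R) : \prod_i p (s i) != 0 -> ~~ atypical d s ->
  expR (- (n%:R * (mean p info + d))) <= lik (vmap x s) (vmap w s) <=
  expR (- (n%:R * (mean p info - d))).
Proof.
move=> ps; rewrite -ltNge ltr_norml => /andP[h1 h2].
by rewrite likE // !ler_expR !lerN2; apply/andP; split; lra.
Qed.

(* For fixed side information at most [#|M|] source words are decoded correctly. *)
Lemma counting_converse (d : R) : 0 < d ->
  exists2 C : R, 0 <= C & forall n, (0 < n)%N ->
  forall (M : finType) (code : {ffun 'I_n -> X} -> M)
    (dec : M -> {ffun 'I_n -> W} -> {ffun 'I_n -> X}),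
  mean_n p (fun s : {ffun 'I_n -> T} =>
    (dec (code (vmap x s)) (vmap w s) == vmap x s)%:R) <=
  C / n%:R + #|M|%:R * expR (- (n%:R * (mean p info - d))).
Proof.
move=> d0; have [C C0 hC] := weak_law hp info d0; exists C => // n n0 M code dec.
set th := expR _.
pose G (a : {ffun 'I_n -> X}) b : R := ((dec (code a) b == a) && (lik a b <= th))%:R.
apply: le_trans (lerD (hC n n0) (lexx _)).
apply: (@le_trans _ _ (mean_n p (fun s : {ffun 'I_n -> T} =>
    (atypical d s)%:R + G (vmap x s) (vmap w s)))).
  (* A correctly decoded sequence is either atypical or has likelihood at most [th]. *)
  apply: le_mean_n => // s ps; rewrite /G -natrD ler_nat.
  case: (boolP (atypical d s)) => [_|/(likP ps)/andP[_ ->]]; last by rewrite andbT.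
  by case: (_ == _).
rewrite mean_nD lerD2l mean_n_marg //.
apply: (@le_trans _ _ (\sum_(b : {ffun 'I_n -> W}) (\prod_i marg p w (b i)) * (#|M|%:R * th)));
  last first.
  rewrite -mulr_suml -(bigA_distr_bigA (fun _ b => marg p w b)) /=.
  by rewrite big1 ?mul1r // => i _; exact: sum_marg1.
apply: ler_sum => b _; rewrite ler_wpM2l //.
  by apply: prodr_ge0 => i _; exact: marg_ge0.
apply: (@le_trans _ _ (\sum_a (dec (code a) b == a)%:R * th)).
  apply: ler_sum => a _; rewrite /G -/(lik a b).
  case: (_ == _); rewrite /= ?mulr0 ?mul0r // mul1r.
  by case: (boolP (lik a b <= th)) => // h; rewrite ?mulr1 ?mulr0 ?expR_ge0.
rewrite -mulr_suml ler_wpM2r ?expR_ge0 // -natr_sum ler_nat.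
(* With [b] fixed, each message is decoded to exactly one word, so the correctly decoded words
   number at most [#|M|]. *)
apply: (@leq_trans (\sum_a \sum_(m : M) (dec m b == a))%N).
  by apply: leq_sum => a _; rewrite (bigD1 (code a)) //= leq_addr.
rewrite exchange_big /= -sum1_card; apply: leq_sum => m _.
rewrite (bigD1 (dec m b)) //= eqxx big1 // => a.
by rewrite eq_sym => /negPf ->.
Qed.

(** For uniformly random [F] the values at [a] and [a'] are independent, and [g] has fibres of equal
    size, so the two bins agree with probability exactly [1 / #|M|]. The map [g] extracts from the
    full bin index what one decoder sees, which lets a single [F] serve both decoders. *)
Lemma card_collision (S K M : finType) (g : K -> M) (a a' : S) :
  (forall m, ((\sum_(k : K) (g k == m)) * #|M| = #|K|)%N) -> a != a' ->
  ((\sum_(F : {ffun S -> K}) (g (F a) == g (F a'))) * #|M| = #|{ffun S -> K}|)%N.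
Proof.
move=> gu aa'.
(* For fixed [m], the event that both bins equal [m] is a product over all points of [S], trivial
   away from [a] and [a']; summing over [F] then factors. *)
pose f m (t : S) (k : K) : nat := if (t == a) || (t == a') then g k == m else true.
have E (F : {ffun S -> K}) : nat_of_bool (g (F a) == g (F a')) = (\sum_m \prod_t f m t (F t))%N.
  have fE m : (\prod_t f m t (F t) = (g (F a) == m) * (g (F a') == m))%N.
    rewrite (bigD1 a) //= (bigD1 a') /=; last by rewrite eq_sym.
    rewrite /f !eqxx orbT big1 ?muln1 // => t /andP[/negPf -> /negPf -> //].
  rewrite (bigD1 (g (F a))) //= fE eqxx mul1n big1 ?addn0; first by rewrite eq_sym.
  by move=> m; rewrite fE eq_sym => /negPf ->.
rewrite (eq_bigr _ (fun F _ => E F)) exchange_big /=.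
have split2 (h : S -> nat) : \prod_t h t =
    (h a * (h a' * \prod_(t | (t != a) && (t != a')) h t))%N.
  by rewrite (bigD1 a) //= (bigD1 a') //= eq_sym.
rewrite card_ffun -prod_nat_const split2 big_distrl /=.
set r := \prod_(t | _) _.
rewrite (eq_bigr (fun m => (\sum_k (g k == m)) * (#|K| * r))%N) => [|m _].
  rewrite -big_distrl /= exchange_big /= -sum1_card; congr (_ * _)%N.
  by apply: eq_bigr => k _; rewrite (bigD1 (g k)) //= eqxx big1 // => m;
    rewrite eq_sym => /negPf ->.
rewrite -bigA_distr_bigA split2 /= /f !eqxx orbT -[in RHS](gu m).
rewrite (_ : \prod_(t | _) _ = r); first by rewrite -mulnA; congr (_ * _)%N; rewrite mulnAC.
apply: eq_bigr => t /andP[/negPf -> /negPf ->].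
by rewrite sum1_card.
Qed.

(** The sum over [F] is the average over random codes, multiplied by their number. An error requires
    an atypical sequence or a wrong word of high likelihood in the same bin. The bound is on the
    average, not for one good [F], so that the bounds for two decoders can be added before [F] is
    chosen. *)
Lemma random_binning (d : R) : 0 < d ->
  exists2 C : R, 0 <= C & forall n, (0 < n)%N ->
  forall (K M : finType) (g : K -> M),
  (forall m, ((\sum_(k : K) (g k == m)) * #|M| = #|K|)%N) -> (0 < #|M|)%N ->
  exists dec : {ffun {ffun 'I_n -> X} -> K} -> M -> {ffun 'I_n -> W} -> {ffun 'I_n -> X},
  \sum_F mean_n p (fun s : {ffun 'I_n -> T} =>
    (dec F (g (F (vmap x s))) (vmap w s) != vmap x s)%:R) <=
  #|{ffun {ffun 'I_n -> X} -> K}|%:R *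
  (C / n%:R + expR (n%:R * (mean p info + d)) / #|M|%:R).
Proof.
move=> d0; have [C C0 hC] := weak_law hp info d0; exists C => // n n0 K M g gu M0.
have [t0 _] := pmf_inhabited hp.
set th := expR _; have th0 : 0 < th by exact: expR_gt0.
(* The decoder returns some sufficiently likely word of the received bin. The constant default word
   is returned only if there is none, which cannot happen for a typical sequence. *)
pose dec (F : {ffun {ffun 'I_n -> X} -> K}) m (b : {ffun 'I_n -> W}) :=
  odflt [ffun=> x t0] [pick a | (th^-1 <= lik a b) && (g (F a) == m)].
exists dec; rewrite -mean_n_sum.
set NF : R := #|_|%:R.
apply: (@le_trans _ _ (mean_n p (fun s : {ffun 'I_n -> T} =>
    (atypical d s)%:R * NF + NF / #|M|%:R * th))); last first.
  rewrite mean_nD mean_n_cst // /mean_n.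
  under eq_bigr do rewrite mulrA.
  rewrite -mulr_suml mulrC mulrDr lerD // ?ler_wpM2l ?hC //.
  by rewrite mulrAC mulrA.
apply: le_mean_n => // s ps /=.
(* Union bound over the wrong words [a]. *)
apply: (@le_trans _ _ (\sum_(F : {ffun {ffun 'I_n -> X} -> K}) ((atypical d s)%:R +
   \sum_(a | a != vmap x s) ((th^-1 <= lik a (vmap w s))%R%:R *
     (g (F a) == g (F (vmap x s)))%:R)))).
  apply: ler_sum => F _.
  have [_|/(likP ps)/andP[tp _]] := boolP (atypical d s).
    apply: (@le_trans _ _ 1); first by rewrite lern1 leq_b1.
    by rewrite lerDl; apply: sumr_ge0 => a _; rewrite mulr_ge0.
  rewrite add0r /dec; case: pickP => [a /andP[h1 h2]|/(_ (vmap x s))] /=.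
    have [//|ne] := eqVneq a (vmap x s); first by rewrite sumr_ge0 // => a' _; rewrite mulr_ge0.
    rewrite (bigD1 a) //= h1 h2 mulr1 lerDl.
    by apply: sumr_ge0 => a' _; rewrite mulr_ge0.
  by rewrite eqxx andbT /th -expRN tp.
rewrite big_split /= sumr_const -[X in X + _]mulr_natr lerD //.
rewrite exchange_big /=.
apply: (@le_trans _ _ (\sum_(a : {ffun 'I_n -> X}) (NF / #|M|%:R) *
    (th^-1 <= lik a (vmap w s))%R%:R)).
  rewrite [leRHS](bigD1 (vmap x s)) //= ler_wpDl ?mulr_ge0 ?invr_ge0 //.
  apply: ler_sum => a ane; rewrite -mulr_sumr mulrC ler_wpM2r //.
  rewrite ler_pdivlMr ?ltr0n // -natr_sum -natrM ler_nat.
  by rewrite (card_collision gu).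
(* At most [th] words have likelihood at least [th^-1]. *)
rewrite -mulr_sumr ler_wpM2l ?mulr_ge0 ?invr_ge0 //.
by rewrite -[leRHS]invrK sum_lik_gt_le // invr_gt0.
Qed.

End Coding.

(** * The single-letter region and erasure channels *)

Section SingleLetter.
Variable R : realType.

Lemma sum_pair (I J : finType) (F : I * J -> R) : \sum_t F t = \sum_i \sum_j F (i, j).
Proof. by rewrite pair_bigA; apply: eq_bigr => -[]. Qed.

Lemma sum_option (I : finType) (F : option I -> R) :
  \sum_a F a = F None + \sum_i F (Some i).
Proof.
rewrite (bigD1 None) //=; congr (_ + _).
rewrite (reindex_omap Some id) => [|[]//].
by apply: eq_bigl => i; rewrite /= eqxx.
Qed.

Lemma sum_delta (I : finType) (F : I -> R) (i : I) : \sum_j F j * (i == j)%:R = F i.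
Proof.
rewrite (bigD1 i) //= eqxx mulr1 big1 ?addr0 // => j.
by rewrite eq_sym => /negPf ->; rewrite mulr0.
Qed.

Lemma condent_marg (T T' X W : finType) (p : {ffun T -> R}) (p' : {ffun T' -> R})
  (x : T -> X) (w : T -> W) (x' : T' -> X) (w' : T' -> W) :
  (forall a b, marg p (fun t => (x t, w t)) (a, b) = marg p' (fun t => (x' t, w' t)) (a, b)) ->
  condent p x w = condent p' x' w'.
Proof.
move=> h; rewrite /condent /ent -!/(marg _ _ _); congr (- _ - - _); apply: eq_bigr => b _;
  congr xlog2x.
  by case: b => a b; exact: h.
rewrite -!/(marg _ _ _) -(marg_pairl p x) -(marg_pairl p' x').
by apply: eq_bigr => a _; exact: h.
Qed.

Definition erasure (X : finType) (k : R) (x : X) (a : option X) : R :=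
  if a is Some y then (1 - k) * (x == y)%:R else k.

Lemma erasure_ge0 (X : finType) k (x : X) a : 0 <= k <= 1 -> 0 <= erasure k x a.
Proof.
by case/andP=> k0 k1; case: a => //= y; rewrite mulr_ge0 // subr_ge0.
Qed.

Lemma sum_erasure (X : finType) k (x : X) : \sum_a erasure k x a = 1.
Proof. by rewrite sum_option /= sum_delta addrC subrK. Qed.

(** An unerased letter reveals [x] and an erased one reveals nothing. Accordingly, the entropies of
    [(x, a, w)] and [(a, w)] have the same unerased part, which cancels, and their erased parts are
    those of [(x, w)] and [w] with all masses scaled by [k]. *)
Lemma condent_erasure (T X W : finType) (p : {ffun T -> R})
    (x : T -> X) (a : T -> option X) (w : T -> W) (k : R) :
  is_pmf p -> 0 <= k <= 1 ->
  (forall x0 a0 w0, marg p (fun t => (x t, (a t, w t))) (x0, (a0, w0)) =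
     erasure k x0 a0 * marg p (fun t => (x t, w t)) (x0, w0)) ->
  condent p x (fun t => (a t, w t)) = k * condent p x w.
Proof.
move=> hp /andP[k0 k1] h.
pose q x0 w0 := marg p (fun t => (x t, w t)) (x0, w0).
have q0 x0 w0 : 0 <= q x0 w0 by exact: marg_ge0.
have qW w0 : marg p w w0 = \sum_x0 q x0 w0 by rewrite -(marg_pairl p x).
have haw a0 w0 : marg p (fun t => (a t, w t)) (a0, w0) = \sum_x0 erasure k x0 a0 * q x0 w0.
  by rewrite -(marg_pairl p x); apply: eq_bigr => x0 _; exact: h.
have e1 : ent p (fun t => (x t, (a t, w t))) =
    - (\sum_x0 \sum_w0 xlog2x (k * q x0 w0) + \sum_x0 \sum_w0 xlog2x ((1 - k) * q x0 w0)).
  rewrite /ent sum_pair -big_split /=; congr (- _); apply: eq_bigr => x0 _.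
  rewrite sum_pair sum_option; congr (_ + _).
    by apply: eq_bigr => w0 _; congr xlog2x; exact: h.
  rewrite exchange_big; apply: eq_bigr => w0 _ /=.
  rewrite -[RHS](sum_delta (fun=> xlog2x ((1 - k) * q x0 w0)) x0); apply: eq_bigr => y _.
  rewrite -/(marg _ _ _) h /= -/(q _ _); case: (x0 == y); rewrite ?mulr1 ?mulr0 ?mul0r //.
  by rewrite /xlog2x eqxx.
have e2 : ent p (fun t => (a t, w t)) =
    - (\sum_w0 xlog2x (k * marg p w w0) + \sum_x0 \sum_w0 xlog2x ((1 - k) * q x0 w0)).
  rewrite /ent sum_pair sum_option; congr (- (_ + _)).
    by apply: eq_bigr => w0 _; congr xlog2x; rewrite -/(marg _ _ _) haw qW mulr_sumr.
  apply: eq_bigr => y _; apply: eq_bigr => w0 _; congr xlog2x; rewrite -/(marg _ _ _) haw /=.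
  rewrite -(sum_delta (fun x0 => (1 - k) * q x0 w0) y); apply: eq_bigr => x0 _.
  by rewrite eq_sym mulrAC.
(* Scaling a pmf by [k] multiplies the sum by [k] and adds [xlog2x k]; this extra term is the same
   in [e4] and drops out of the difference. *)
have e3 : \sum_x0 \sum_w0 xlog2x (k * q x0 w0) =
    k * (\sum_x0 \sum_w0 xlog2x (q x0 w0)) + xlog2x k.
  rewrite mulr_sumr -[X in _ + X]mul1r -[in X in _ + X](sum_marg1 hp (fun t => (x t, w t))).
  rewrite sum_pair mulr_suml -big_split /=.
  apply: eq_bigr => x0 _; rewrite mulr_sumr mulr_suml -big_split; apply: eq_bigr => w0 _.
  by rewrite xlog2xM.
have e4 : \sum_w0 xlog2x (k * marg p w w0) =
    k * (\sum_w0 xlog2x (marg p w w0)) + xlog2x k.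
  rewrite mulr_sumr -[X in _ + X]mul1r -[in X in _ + X](sum_marg1 hp w).
  rewrite mulr_suml -big_split /=; apply: eq_bigr => w0 _.
  by rewrite xlog2xM // marg_ge0.
rewrite {1}/condent e1 e2 e3 e4 /condent /ent sum_pair.
rewrite -/(marg _ _ _).
rewrite (_ : \sum_x0 \sum_w0 xlog2x (\sum_(t | _ == (x0, w0)) p t) =
    \sum_x0 \sum_w0 xlog2x (q x0 w0)) //.
rewrite (_ : \sum_s xlog2x (\sum_(t | w t == s) p t) = \sum_w0 xlog2x (marg p w w0)) //.
ring.
Qed.

(** * Marginals of the members of the family [in_Pstar] *)

Section Channel.
Variables (X U V A B Y : finType) (Q : {ffun src X U V -> R}).
Variables (p : {ffun A * B * X * U * V -> R}) (W : X -> A * B -> R) (k : U -> V -> Y).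
Hypothesis pW : forall a b x u v, p (a, b, x, u, v) = W x (a, b) * QXUV Q x u v.

(** Given [x], the pair [(a, b)] is independent of [(u, v)], so the sum splits into two factors. The
    map [k] will be either projection of [(u, v)], so one computation covers both decoders. *)
Lemma sum_Pstar (phi : pred (A * B)) (x0 : X) (y0 : Y) :
  \sum_(t | phi t.1.1.1 && ((t.1.1.2, k t.1.2 t.2) == (x0, y0))) p t =
  (\sum_(ab | phi ab) W x0 ab) * marg Q (fun s => (s.1.1.1, k s.1.2 s.2)) (x0, y0).
Proof.
pose S := \sum_u \sum_(v | k u v == y0) QXUV Q x0 u v.
transitivity ((\sum_(ab | phi ab) W x0 ab) * S).
  rewrite big_mkcond !sum_pair.
  rewrite [in RHS]big_mkcond !sum_pair mulr_suml; apply: eq_bigr => a _.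
  rewrite mulr_suml; apply: eq_bigr => b _ /=.
  rewrite (bigD1 x0) //= [X in _ + X]big1 ?addr0 => [|x xx0]; last first.
    rewrite big1 // => u _; rewrite big1 // => v _.
    by rewrite xpair_eqE (negPf xx0) andbF.
  case: (phi (a, b)); last by rewrite mul0r big1 // => u _; rewrite big1.
  rewrite mulr_sumr; apply: eq_bigr => u _; rewrite [in RHS]big_mkcond mulr_sumr;
    apply: eq_bigr => v _.
  by rewrite xpair_eqE eqxx /= pW; case: ifP; rewrite ?mulr0.
congr (_ * _); rewrite /marg big_mkcond !sum_pair (bigD1 x0) //=.
rewrite [X in _ = _ + X]big1 ?addr0 => [|x xx0]; last first.
  rewrite big1 // => y _; rewrite big1 // => u _; rewrite big1 // => v _.
  by case: ifP => //= /eqP[xE]; rewrite xE eqxx in xx0.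
rewrite [RHS]exchange_big; apply: eq_bigr => u _ /=.
rewrite [RHS]exchange_big big_mkcond; apply: eq_bigr => v _ /=.
have -> : ((x0, k u v) == (x0, y0)) = (k u v == y0) by rewrite xpair_eqE eqxx.
by case: ifP => // _; rewrite big1.
Qed.

Hypothesis W1 : forall x, \sum_ab W x ab = 1.

Lemma marg_Pstar (x0 : X) (y0 : Y) :
  marg p (fun t => (t.1.1.2, k t.1.2 t.2)) (x0, y0) =
  marg Q (fun s => (s.1.1.1, k s.1.2 s.2)) (x0, y0).
Proof. by rewrite -[RHS]mul1r -[in RHS](W1 x0) -sum_Pstar. Qed.

Lemma condent_Pstar :
  condent p (fun t => t.1.1.2) (fun t => k t.1.2 t.2) =
  condent Q (fun s => s.1.1.1) (fun s => k s.1.2 s.2).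
Proof. by apply: condent_marg => a b; exact: marg_Pstar. Qed.

Lemma pmf_Pstar : is_pmf Q -> (forall x ab, 0 <= W x ab) -> is_pmf p.
Proof.
move=> HQ W0; split.
  case=> [[[[a b] x] u] v]; rewrite pW mulr_ge0 //.
  by apply: sumr_ge0 => y _; case: HQ => ->.
rewrite -[RHS](sum_marg1 HQ (fun s => (s.1.1.1, k s.1.2 s.2))).
rewrite (partition_big (fun t => (t.1.1.2, k t.1.2 t.2)) xpredT) //=.
by apply: eq_bigr => -[a b] _; exact: marg_Pstar.
Qed.

Lemma marg_Pstar_channel (C : finType) (c : A * B -> C) (x0 : X) (c0 : C) (y0 : Y) :
  marg p (fun t => (t.1.1.2, (c t.1.1.1, k t.1.2 t.2))) (x0, (c0, y0)) =
  (\sum_(ab | c ab == c0) W x0 ab) * marg p (fun t => (t.1.1.2, k t.1.2 t.2)) (x0, y0).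
Proof.
rewrite marg_Pstar -(sum_Pstar (fun ab => c ab == c0)); apply: eq_bigl => t.
by rewrite !xpair_eqE andbCA.
Qed.

End Channel.

(** * The polyhedron of rates and its equality with the single-letter union *)

Definition sw_region (hu hv : R) : set (R * R * R) :=
  [set r | [/\ 0 <= r.1.1, 0 <= r.1.2, 0 <= r.2,
     hu <= r.1.1 + r.1.2 & hv <= r.1.1 + r.2]].

Lemma erasure_split (h r0 r1 : R) : 0 <= h -> 0 <= r0 -> 0 <= r1 -> h <= r0 + r1 ->
  exists k, [/\ 0 <= k <= 1, k * h <= r0 & h - k * h <= r1].
Proof.
rewrite le_eqVlt => /predU1P[<- r00 r10 _|h0 r00 r10 hr].
  by exists 0; rewrite lexx ler01 mulr0 subr0.
have [hr0|/ltW r0h] := leP h r0; first by exists 1; rewrite ler01 lexx mul1r subrr.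
(* The erasure probability that makes the constraint on [r0] tight; it is below 1 because [r0 < h]
   in this case. *)
exists (r0 / h); rewrite divfK ?lt0r_neq0 // lexx lerBlDl hr; split => //.
by apply/andP; split; [rewrite divr_ge0 // ltW|rewrite ler_pdivrMr // mul1r].
Qed.

Lemma inner_unionE (X U V : finType) (Q : {ffun src X U V -> R}) : is_pmf Q ->
  inner_union Q = sw_region (condent Q (fun s => s.1.1.1) (fun s => s.1.2))
                            (condent Q (fun s => s.1.1.1) (fun s => s.2)).
Proof.
move=> HQ; apply/seteqP; split => [[[r0 r1] r2]|[[r0 r1] r2] [/= r00 r10 r20 hu hv]].
  move=> [A [B [_ _ [p [[W [W0 [W1 pW]]]]]]]].
  case=> /=; rewrite ge_max => /andP[h1 h2] h3 h4.
  have hp := pmf_Pstar (fun u _ => u) pW W1 HQ W0.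
  rewrite /sw_region /= -(condent_Pstar (fun u _ => u) pW W1)
    -(condent_Pstar (fun _ v => v) pW W1).
  split.
  - by apply: le_trans h1; exact: condent_ge0.
  - by apply: le_trans h3; exact: cmi_ge0.
  - by apply: le_trans h4; exact: cmi_ge0.
  (* [H(X|A,U)] and [I(X;A|U)] add up to [H(X|U)]. *)
  - by apply: le_trans (lerD h1 h3); rewrite /cmi addrC subrK.
  - by apply: le_trans (lerD h2 h4); rewrite /cmi addrC subrK.
have [k [k01 ka kb]] := erasure_split (condent_ge0 HQ _ _) r00 r10 hu.
have [l [l01 la lb]] := erasure_split (condent_ge0 HQ _ _) r00 r20 hv.
exists (option X), (option X); split; rewrite ?card_option //.
(* Given [x], the letters [a] and [b] are independent erasures with probabilities [k] and [l], so
   each of the two rate splits is tuned separately. *)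
pose W x (ab : option X * option X) := erasure k x ab.1 * erasure l x ab.2.
pose p := [ffun t : option X * option X * X * U * V =>
  W t.1.1.2 t.1.1.1 * QXUV Q t.1.1.2 t.1.2 t.2].
have pW a b x u v : p (a, b, x, u, v) = W x (a, b) * QXUV Q x u v by rewrite ffunE.
have W0 x ab : 0 <= W x ab by rewrite mulr_ge0 // erasure_ge0.
have Wa x a : \sum_(ab | ab.1 == a) W x ab = erasure k x a.
  rewrite (eq_bigl (fun ab => (ab.1 == a) && true)) => [|ab]; last by rewrite andbT.
  rewrite -(pair_big (fun a' => a' == a) xpredT (fun a b => erasure k x a * erasure l x b)).
  by rewrite big_pred1_eq -mulr_sumr sum_erasure mulr1.
have Wb x b : \sum_(ab | ab.2 == b) W x ab = erasure l x b.
  rewrite -(pair_big xpredT (fun b' => b' == b) (fun a b => erasure k x a * erasure l x b)).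
  by under eq_bigr do rewrite big_pred1_eq; rewrite -mulr_suml sum_erasure mul1r.
have W1 x : \sum_ab W x ab = 1.
  rewrite -(pair_bigA _ (fun a b => erasure k x a * erasure l x b)) /=.
  by under eq_bigr do rewrite -mulr_sumr sum_erasure mulr1; rewrite sum_erasure.
have hp := pmf_Pstar (fun u _ => u) pW W1 HQ W0.
have ha : condent p (fun t => t.1.1.2) (fun t => (t.1.1.1.1, t.1.2)) =
    k * condent Q (fun s => s.1.1.1) (fun s => s.1.2).
  rewrite -(condent_Pstar (fun u _ => u) pW W1); apply: condent_erasure => // x0 a0 w0.
  by rewrite (marg_Pstar_channel (fun u _ => u) pW W1 fst) Wa.
have hb : condent p (fun t => t.1.1.2) (fun t => (t.1.1.1.2, t.2)) =
    l * condent Q (fun s => s.1.1.1) (fun s => s.2).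
  rewrite -(condent_Pstar (fun _ v => v) pW W1); apply: condent_erasure => // x0 a0 w0.
  by rewrite (marg_Pstar_channel (fun _ v => v) pW W1 snd) Wb.
exists p; split; first by exists W.
split; rewrite /= ?ge_max /cmi /= ?ha ?hb ?ka ?la //.
  by rewrite (condent_Pstar (fun u _ => u) pW W1).
by rewrite (condent_Pstar (fun _ v => v) pW W1).
Qed.

(** Each constraint is the preimage of a closed half-line under a continuous map. This identifies
    the closure of the union with the polyhedron. *)
Lemma closed_sw_region (hu hv : R) : closed (sw_region hu hv).
Proof.
have c (f : R * R * R -> R) h : continuous f -> closed [set r | h <= f r].
  move=> cf; apply: (@closed_comp _ _ f [set y | h <= y]); last exact: closed_ge.
  by move=> x _; exact: cf.
have c0 : continuous (fun r : R * R * R => r.1.1).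
  by move=> r; apply: (@cvg_comp _ _ _ fst fst); [exact: cvg_fst|exact: cvg_fst].
have c1 : continuous (fun r : R * R * R => r.1.2).
  by move=> r; apply: (@cvg_comp _ _ _ fst snd); [exact: cvg_fst|exact: cvg_snd].
have c2 : continuous (fun r : R * R * R => r.2) by move=> r; exact: cvg_snd.
rewrite (_ : sw_region hu hv = [set r | 0 <= r.1.1] `&` [set r | 0 <= r.1.2] `&`
   [set r | 0 <= r.2] `&` [set r | hu <= r.1.1 + r.1.2] `&` [set r | hv <= r.1.1 + r.2]).
  apply: closedI; last by apply: c => r; apply: cvgD; [exact: c0|exact: c2].
  apply: closedI; last by apply: c => r; apply: cvgD; [exact: c0|exact: c1].
  by apply: closedI; last exact: c; apply: closedI; exact: c.
by apply/seteqP; split=> r /=; [case|case=> [[[[]]]]].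
Qed.

End SingleLetter.

(** * Rates, alphabet sizes and the asymptotic converse *)

Section Rates.
Variable R : realType.

Lemma eventually_div_le (D e : R) : 0 <= D -> 0 < e ->
  exists2 N, (0 < N)%N & forall n, (N <= n)%N -> D / n%:R <= e.
Proof.
move=> D0 e0; exists (Num.bound (D / e)) => // n Nn.
have n0 : 0 < n%:R :> R by rewrite ltr0n; apply: leq_trans Nn.
rewrite ler_pdivrMr // mulrC -ler_pdivrMr // ltW //.
by apply: lt_le_trans (archi_boundP (divr_ge0 D0 (ltW e0))) _; rewrite ler_nat.
Qed.

(** This crude bound turns exponentially small terms into [O(1/n)] ones, so that a single choice of
    [n] handles them together with the Chebyshev term. *)
Lemma expRN_le (y : R) : 0 < y -> expR (- y) <= y^-1.
Proof.
move=> y0; rewrite expRN lef_pV2 ?posrE ?expR_gt0 //.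
by apply: le_trans (expR_ge1Dx y); rewrite lerDr.
Qed.

Lemma log2_rate (m n : nat) (r : R) : (0 < m)%N -> (0 < n)%N ->
  (log2 m%:R / n%:R <= r) = (m%:R <= expR (n%:R * (r * ln 2))).
Proof.
move=> m0 n0; rewrite ler_pdivrMr ?ltr0n // /log2 ler_pdivrMr ?ln2_gt0 //.
rewrite -ler_expR lnK ?posrE ?ltr0n //.
by congr (_ <= expR _); ring.
Qed.

Lemma sum_eqn (I : finType) (i0 : I) : (\sum_i (i == i0) = 1)%N.
Proof. by rewrite (bigD1 i0) //= eqxx big1 // => i /negPf ->. Qed.

(** This and [fiber_fst_snd] supply the equal-fibre condition of [card_collision] for the two
    decoders' views of the triple of indices. *)
Lemma fiber_fst (I J : finType) (i0 : I) : (\sum_(k : I * J) (k.1 == i0) = #|J|)%N.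
Proof.
rewrite -(pair_bigA _ (fun i (j : J) => nat_of_bool (i == i0))) /=.
by under eq_bigr do rewrite sum_nat_const; rewrite -big_distrr /= sum_eqn muln1.
Qed.

Lemma fiber_fst_snd (I J L : finType) (m : I * L) :
  (\sum_(k : I * J * L) ((k.1.1, k.2) == m) = #|J|)%N.
Proof.
rewrite (eq_bigr (fun k => (k.1.1 == m.1) * (k.2 == m.2))%N); last first.
  by move=> k _; rewrite {1}(surjective_pairing m) xpair_eqE mulnb.
rewrite -(pair_bigA _ (fun ij l => (ij.1 == m.1) * (l == m.2))%N) /=.
by under eq_bigr do rewrite -big_distrr /= sum_eqn muln1; rewrite fiber_fst.
Qed.

(** If the rate were below the conditional entropy, the counting bound would make the success
    probability vanish. The slack is [2 * eps] because the message is a pair of indices, each with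
    its own slack [eps]. *)
Lemma converse_rate (T X W : finType) (p : {ffun T -> R}) (x : T -> X) (w : T -> W) (r : R) :
  is_pmf p ->
  (forall eps : R, 0 < eps -> exists N : nat, forall n, (N <= n)%N -> (0 < n)%N ->
   exists (M : finType) (code : {ffun 'I_n -> X} -> M)
     (dec : M -> {ffun 'I_n -> W} -> {ffun 'I_n -> X}),
   mean_n p (fun s : {ffun 'I_n -> T} =>
     (dec (code (vmap x s)) (vmap w s) != vmap x s)%:R) <= eps /\
   #|M|%:R <= expR (n%:R * ((r + 2 * eps) * ln 2)) :> R) ->
  condent p x w <= r.
Proof.
move=> hp hM; rewrite leNgt; apply/negP => hr.
set h := condent p x w in hr; have L0 := ln2_gt0 R.
(* Of the gap [4 * dl], typicality uses one [dl] and the rate slack [2 * eps] at most two; one [dl]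
   remains as the decay exponent. *)
pose dl := (h - r) / 4; have dl0 : 0 < dl by rewrite /dl; lra.
have d0 : 0 < dl * ln 2 by exact: mulr_gt0.
(* The error is at most 1/2 and, for the chosen [n], the success probability at most 1/4, yet they
   add up to 1. *)
pose eps := Num.min dl (1 / 2).
have eps0 : 0 < eps by rewrite lt_min dl0; lra.
have [e1 e2] : eps <= dl /\ eps <= 1 / 2 by split; rewrite ge_min lexx ?orbT.
have [C C0 hC] := counting_converse x w hp d0.
have [N1 hN1] := hM _ eps0.
have D0 : 0 <= C + (dl * ln 2)^-1 by rewrite addr_ge0 // invr_ge0 ltW.
have q0 : 0 < 1 / 4 :> R by lra.
have [N2 N20 hN2] := eventually_div_le D0 q0.
pose n := maxn N1 N2.
have n0 : (0 < n)%N by apply: leq_trans N20 (leq_maxr _ _).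
have nR : 0 < n%:R :> R by rewrite ltr0n.
have [M [code [dec [he hm]]]] := hN1 n (leq_maxl _ _) n0.
have := hC n n0 M code dec; rewrite mean_info // -/h.
have := hN2 n (leq_maxr _ _); rewrite mulrDl -invfM [_ * n%:R]mulrC => small.
set A := mean_n _ _ => hA; set E := mean_n _ _ in he.
have AE : A + E = 1.
  rewrite -mean_nD -[RHS](mean_n_cst hp n 1); apply: eq_bigr => s _.
  by case: (_ == _); rewrite ?addr0 ?add0r.
have : #|M|%:R * expR (- (n%:R * (h * ln 2 - dl * ln 2))) <= (n%:R * (dl * ln 2))^-1.
  apply: le_trans (expRN_le (mulr_gt0 nR d0)).
  apply: le_trans (ler_wpM2r (expR_ge0 _) hm) _.
  rewrite -expRD ler_expR.
  rewrite [leLHS](_ : _ = - (n%:R * ((h - dl - r - 2 * eps) * ln 2))); last by ring.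
  rewrite lerN2; apply: ler_wpM2l; first exact: ltW.
  apply: ler_wpM2r; first exact: ltW.
  by move: e1; rewrite /dl; lra.
lra.
Qed.

End Rates.

(** * The operational rate region equals the polyhedron *)

Section RateRegion.
Variables (R : realType) (X U V : finType) (Q : {ffun src X U V -> R}).
Hypothesis HQ : is_pmf Q.
Hypothesis HXY : forall (x y : X) (u : U) (v : V), x != y -> Q (x, y, u, v) = 0.

Let hu := condent Q (fun s => s.1.1.1) (fun s => s.1.2).
Let hv := condent Q (fun s => s.1.1.1) (fun s => s.2).

Lemma ys_of_xs n (s : {ffun 'I_n -> src X U V}) : \prod_i Q (s i) != 0 -> ys_of s = xs_of s.
Proof.
move=> /prodf_neq0 h; apply/ffunP => i; rewrite !ffunE; have := h i isT.
by case: (s i) => [[[x y] u] v] /=; case: (eqVneq x y) => // /HXY ->; rewrite eqxx.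
Qed.

Lemma achievable_converse r : achievable Q r -> sw_region hu hv r.
Proof.
case: r => [[r0 r1] r2] hr.
(* The encoder takes a value on some constant word, so none of its three index sets is empty. *)
have pos n (m0 m1 m2 : nat)
    (e : {ffun 'I_n -> X} -> {ffun 'I_n -> X} -> 'I_m0 * 'I_m1 * 'I_m2) :
    [/\ (0 < m0)%N, (0 < m1)%N & (0 < m2)%N].
  have [t _] := pmf_inhabited HQ.
  case: (e [ffun=> t.1.1.1] [ffun=> t.1.1.1]) => [[a b] c].
  by split; [case: a|case: b|case: c] => k; apply: leq_ltn_trans.
have nonneg m n (r : R) : (0 < m)%N -> log2 m%:R / n%:R <= r -> 0 <= r.
  move=> m0; apply: le_trans; rewrite divr_ge0 //.
  by rewrite /log2 divr_ge0 // ?ln_ge0 ?ler1n // ltW // ln2_gt0.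
have sw (m m' n : nat) (r r' eps : R) : (0 < n)%N -> (0 < m)%N -> (0 < m')%N ->
    log2 m%:R / n%:R <= r + eps -> log2 m'%:R / n%:R <= r' + eps ->
    #|{: 'I_m * 'I_m'}|%:R <= expR (n%:R * ((r + r' + 2 * eps) * ln 2)) :> R.
  move=> n0 m0 m0'; rewrite !log2_rate // => h h'.
  rewrite card_prod !card_ord natrM; apply: le_trans (ler_pM _ _ h h') _ => //.
  by rewrite -expRD ler_expR le_eqVlt; apply/orP; left; apply/eqP; ring.
split => /=.
- apply/ler_addgt0Pr => eps /hr[N /(_ N (leqnn N))[m0 [m1 [m2 [e [dx [dy [_ h _ _]]]]]]]].
  by have [p0 _ _] := pos _ _ _ _ e; exact: nonneg h.
- apply/ler_addgt0Pr => eps /hr[N /(_ N (leqnn N))[m0 [m1 [m2 [e [dx [dy [_ _ h _]]]]]]]].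
  by have [_ p0 _] := pos _ _ _ _ e; exact: nonneg h.
- apply/ler_addgt0Pr => eps /hr[N /(_ N (leqnn N))[m0 [m1 [m2 [e [dx [dy [_ _ _ h]]]]]]]].
  by have [_ _ p0] := pos _ _ _ _ e; exact: nonneg h.
(* The first decoder alone is a code with message [(M0, M1)]. Feeding [a] twice to the encoder
   changes nothing on the support of [Q]. *)
- apply: converse_rate => // eps /hr[N hN]; exists N => n /hN.
  move=> [m0 [m1 [m2 [e [dx [dy [/= hP h0 h1 _]]]]]]] n0.
  have [p0 p1 _] := pos _ _ _ _ e.
  exists ('I_m0 * 'I_m1)%type, (fun a => (e a a).1), (fun m b => dx m.1 m.2 b).
  split; last exact: sw.
  apply: le_trans hP; rewrite /Perr le_max; apply/orP; left.
  by apply: le_mean_n => // s /ys_of_xs ->.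
- apply: converse_rate => // eps /hr[N hN]; exists N => n /hN.
  move=> [m0 [m1 [m2 [e [dx [dy [/= hP h0 _ h1]]]]]]] n0.
  have [p0 _ p1] := pos _ _ _ _ e.
  exists ('I_m0 * 'I_m2)%type, (fun a => ((e a a).1.1, (e a a).2)), (fun m b => dy m.1 m.2 b).
  split; last exact: sw.
  apply: le_trans hP; rewrite /Perr le_max; apply/orP; right.
  by apply: le_mean_n => // s /ys_of_xs ->.
Qed.

Lemma achievable_direct r : sw_region hu hv r -> achievable Q r.
Proof.
case: r => [[r0 r1] r2] [/= r00 r10 r20 hur hvr] eps eps0.
have L0 := ln2_gt0 R; have d0 : 0 < eps * ln 2 by exact: mulr_gt0.
have [C C0 hC] := random_binning (fun s => s.1.1.1) (fun s => s.1.2) HQ d0.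
have [C' C0' hC'] := random_binning (fun s => s.1.1.1) (fun s => s.2) HQ d0.
(* [C] and [C'] bound the atypical events; each decoder's collision term adds [4 / (eps * ln 2)],
   all divided by [n]. *)
pose D := C + C' + 8 / (eps * ln 2).
have D0 : 0 <= D by rewrite !addr_ge0 // divr_ge0 // ltW.
have [N N0 hN] := eventually_div_le D0 eps0; exists N => n Nn.
have n0 : (0 < n)%N by exact: leq_trans Nn.
have nR : 0 < n%:R :> R by rewrite ltr0n.
pose E r : R := expR (n%:R * ((r + eps) * ln 2)).
have cardP r : 0 <= r -> exists m, [/\ (0 < m)%N, m%:R <= E r & E r <= 2 * m%:R].
  move=> r_ge0; have E1 : 1 <= E r.
    rewrite -expR0 ler_expR; apply: mulr_ge0 => //; apply: mulr_ge0; last exact: ltW.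
    by apply: addr_ge0; last exact: ltW.
  (* Rounding down loses at most a factor 2 since [E r >= 1]; a pair of indices thus loses at most
     4. *)
  exists (Num.truncn (E r)); have E0 := le_trans ler01 E1.
  have /andP[h1 h2] := truncn_itv E0.
  have m0 : (0 < Num.truncn (E r))%N by rewrite truncn_gt0.
  split => //; apply: le_trans (ltW h2) _.
  by rewrite -natrM ler_nat mul2n -addnn -addn1 leq_add2l.
have binrate (m m' : nat) r r' h : (0 < m)%N -> (0 < m')%N -> h <= r + r' ->
    E r <= 2 * m%:R -> E r' <= 2 * m'%:R ->
    expR (n%:R * (h * ln 2 + eps * ln 2)) / (m * m')%:R <= 4 / (eps * ln 2) / n%:R.
  move=> p p' hh e e'.
  have mm : 0 < (m * m')%:R :> R by rewrite ltr0n muln_gt0 p.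
  rewrite ler_pdivrMr //.
  have EE : E r * E r' <= 4 * (m * m')%:R.
    by apply: le_trans (ler_pM (expR_ge0 _) (expR_ge0 _) e e') _; rewrite natrM; lra.
  (* The two indices have total rate slack [2 * eps], of which typicality consumes [eps]; the rest
     gives the decaying factor. *)
  apply: (@le_trans _ _ (E r * E r' * expR (- (n%:R * (eps * ln 2))))).
    rewrite -!expRD ler_expR.
    rewrite [leRHS](_ : _ = n%:R * ((r + r' + eps) * ln 2)); last by ring.
    rewrite -mulrDl; apply: ler_wpM2l; first exact: ltW.
    by apply: ler_wpM2r; [exact: ltW|lra].
  apply: le_trans (ler_pM _ (expR_ge0 _) EE (expRN_le (mulr_gt0 nR d0))) _.
    by rewrite mulr_ge0 // expR_ge0.
  by rewrite invfM le_eqVlt; apply/orP; left; apply/eqP; ring.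
have [m0 [p0 u0 l0]] := cardP _ r00.
have [m1 [p1 u1 l1]] := cardP _ r10.
have [m2 [p2 u2 l2]] := cardP _ r20.
pose K : finType := ('I_m0 * 'I_m1 * 'I_m2)%type.
have g1 (m : 'I_m0 * 'I_m1) :
    ((\sum_(k : K) (k.1 == m)) * #|{: 'I_m0 * 'I_m1}| = #|K|)%N.
  by rewrite fiber_fst !card_prod !card_ord mulnC.
have g2 (m : 'I_m0 * 'I_m2) :
    ((\sum_(k : K) ((k.1.1, k.2) == m)) * #|{: 'I_m0 * 'I_m2}| = #|K|)%N.
  by rewrite fiber_fst_snd !card_prod !card_ord mulnCA mulnA.
have [|dec1 hdec1] := hC n n0 _ _ _ g1; first by rewrite card_prod !card_ord muln_gt0 p0.
have [|dec2 hdec2] := hC' n n0 _ _ _ g2; first by rewrite card_prod !card_ord muln_gt0 p0.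
set NF : R := #|_|%:R in hdec1 hdec2.
have [F hF] : exists F : {ffun {ffun 'I_n -> X} -> K},
    mean_n Q (fun s => (dec1 F (F (xs_of s)).1 (us_of s) != xs_of s)%:R) +
    mean_n Q (fun s => (dec2 F ((F (xs_of s)).1.1, (F (xs_of s)).2) (vs_of s) != xs_of s)%:R)
    <= eps.
  (* If every [F] had total error above [eps], so would the average, contradicting the sum of the
     two binning bounds. *)
  apply/existsP; apply: contraT; rewrite negb_exists => /forallP hF.
  have NF0 : 0 < NF.
    rewrite ltr0n; apply/card_gt0P.
    by exists [ffun=> (Ordinal p0, Ordinal p1, Ordinal p2)].
  have : NF * eps < NF * eps; last by rewrite ltxx.
  apply: (@lt_le_trans _ _ (NF * (D / n%:R))); last by rewrite ler_pM2l // hN.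
  apply: (@lt_le_trans _ _ (\sum_(F : {ffun {ffun 'I_n -> X} -> K})
    (mean_n Q (fun s => (dec1 F (F (xs_of s)).1 (us_of s) != xs_of s)%:R) +
     mean_n Q (fun s => (dec2 F ((F (xs_of s)).1.1, (F (xs_of s)).2) (vs_of s) != xs_of s)%:R)))).
    have -> : NF * eps = \sum_(F : {ffun {ffun 'I_n -> X} -> K}) eps.
      by rewrite sumr_const mulr_natl.
    apply: ltr_sum => [|F _]; last by rewrite ltNge hF.
    by apply/hasP; exists [ffun=> (Ordinal p0, Ordinal p1, Ordinal p2)]; rewrite ?mem_index_enum.
  rewrite big_split /=; apply: le_trans (lerD hdec1 hdec2) _.
  rewrite -mulrDr ler_pM2l // !card_prod !card_ord !mean_info //.
  have b1 := binrate _ _ _ _ _ p0 p1 hur l0 l1.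
  have b2 := binrate _ _ _ _ _ p0 p2 hvr l0 l2.
  apply: le_trans (lerD (lerD (lexx _) b1) (lerD (lexx _) b2)) _.
  by rewrite le_eqVlt; apply/orP; left; apply/eqP; rewrite /D; ring.
exists m0, m1, m2, (fun a _ => F a),
    (fun m m' b => dec1 F (m, m') b), (fun m m' b => dec2 F (m, m') b).
split; rewrite ?log2_rate //.
rewrite /Perr ge_max; apply/andP; split; apply: le_trans hF.
- rewrite (_ : prob_n _ _ = mean_n Q (fun s => (dec1 F (F (xs_of s)).1 (us_of s) != xs_of s)%:R)).
    by rewrite lerDl; apply: sumr_ge0 => s _; rewrite mulr_ge0 // prod_pmf_ge0.
  by apply: eq_bigr => s _ /=; rewrite -surjective_pairing.
(* The second decoder estimates the word [xs_of s], which is [ys_of s] on the support of [Q]. *)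
- apply: (@le_trans _ _ (mean_n Q (fun s =>
    (dec2 F ((F (xs_of s)).1.1, (F (xs_of s)).2) (vs_of s) != xs_of s)%:R))).
    by apply: le_mean_n => // s /ys_of_xs ->.
  by rewrite lerDr; apply: sumr_ge0 => s _; rewrite mulr_ge0 // prod_pmf_ge0.
Qed.

Lemma rate_regionE : rate_region Q = sw_region hu hv.
Proof.
by apply/seteqP; split => r; [exact: achievable_converse|exact: achievable_direct].
Qed.

End RateRegion.

Unset Implicit Arguments.
Set Strict Implicit.

Theorem theorem4 (R : realType) (X U V : finType)
  (Q : {ffun (X * X * U * V)%type -> R})
  (HQ : is_pmf Q)
  (HXY : forall (x y : X) (u : U) (v : V), x != y -> Q (x, y, u, v) = 0) :
  rate_region Q = closure (inner_union Q).
Proof.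
rewrite inner_unionE // -(proj1 (closure_id _) (@closed_sw_region _ _ _)).
exact: rate_regionE.
Qed.
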